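(* Let $m\in\{2,3\}$ and let $F,F'\colon\mathbb F_2^6\to\mathbb F_2^m$ be bent functions. Then $F$ and $F'$ are extended-affine equivalent if and only if the translation designs $\operatorname{dev}(G_F)$ and $\operatorname{dev}(G_{F'})$ are isomorphic.
   Context: An $(n,m)$-function $F\colon\mathbb F_2^n\to\mathbb F_2^m$ is bent if $\sum_{\mathbf x}(-1)^{\langle\mathbf b,F(\mathbf x)\rangle\oplus\langle\mathbf a,\mathbf x\rangle}=\pm2^{n/2}$ for all $\mathbf a$ and all $\mathbf b\ne\mathbf0$. EA-equivalence: $F=A_1\circ F'\circ A_2\oplus A_3$ with $A_1$ a linear permutation of $\mathbb F_2^m$, $A_2$ an affine permutation of $\mathbb F_2^n$, $A_3$ affine. $G_F=\{(\mathbf x,F(\mathbf x)):\mathbf x\in\mathbb F_2^n\}\subseteq\mathbb F_2^n\times\mathbb F_2^m$ is the graph of $F$, and $\operatorname{dev}(G_F)$ is the incidence structure with point set $\mathbb F_2^n\times\mathbb F_2^m$ and blocks the translates $G_F+g$, $g\in\mathbb F_2^n\times\mathbb F_2^m$. Two incidence structures are isomorphic if their incidence matrices satisfy $M=PM'Q$ for permutation matrices $P,Q$. *)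

(* Defs.v *)
From HB Require Import structures.
From mathcomp Require Import all_boot all_order all_algebra all_fingroup.
Set Implicit Arguments. Unset Strict Implicit. Unset Printing Implicit Defensive.
Import GRing.Theory.
Local Open Scope ring_scope.

Notation vec n := 'rV['F_2]_n.

Definition dotF2 n (a x : vec n) : 'F_2 := (x *m a^T) 0 0.

Definition sgnF2 (e : 'F_2) : int := (-1) ^+ (nat_of_ord e).

Definition walsh n m (F : vec n -> vec m) (a : vec n) (b : vec m) : int :=
  \sum_(x : vec n) sgnF2 (dotF2 b (F x) + dotF2 a x).

Definition bent n m (F : vec n -> vec m) : Prop :=
  forall (a : vec n) (b : vec m), b != 0 ->
    walsh F a b = (2 ^ n./2)%:Z \/ walsh F a b = - (2 ^ n./2)%:Z.

Definition EA_equiv n m (F F' : vec n -> vec m) : Prop :=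
  exists (M1 : 'M['F_2]_m) (L2 : 'M['F_2]_n) (c2 : vec n)
         (N3 : 'M['F_2]_(n, m)) (d3 : vec m),
    M1 \in unitmx /\ L2 \in unitmx /\
    forall x : vec n, F x = F' (x *m L2 + c2) *m M1 + (x *m N3 + d3).

Definition point n m := (vec n * vec m)%type.

Definition padd n m (p g : point n m) : point n m := (p.1 + g.1, p.2 + g.2).

Definition graphF n m (F : vec n -> vec m) : {set point n m} :=
  [set (x, F x) | x : vec n].

Definition translate n m (S : {set point n m}) (g : point n m) : {set point n m} :=
  [set padd p g | p in S].

Definition dev_blocks n m (F : vec n -> vec m) : {set {set point n m}} :=
  [set translate (graphF F) g | g : point n m].

(* Isomorphism of incidence structures (same point set): a bijection of points
   mapping the block set of the second structure onto the block set of the first.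
   This is equivalent to M = P M' Q for the incidence matrices. *)
Definition dev_iso n m (F F' : vec n -> vec m) : Prop :=
  exists phi : {perm point n m},
    [set [set phi p | p in B] | B : {set point n m} in dev_blocks F'] = dev_blocks F.

(* Main.v *)
Require Import Defs.
From HB Require Import structures.
From mathcomp Require Import all_boot all_order all_algebra all_fingroup.
From mathcomp Require Import all_solvable mxabelem zify ring.
Set Implicit Arguments. Unset Strict Implicit. Unset Printing Implicit Defensive.
Import GroupScope GRing.Theory Num.Theory.
Local Open Scope ring_scope.

(* Write [V] and [U] for the source and the target of [F]. The incidence graph of
   dev(G_F) is the Cayley graph of the elementary abelian group W = F_2 x V x U with
   connection set {(1, a, F a)}: points have first coordinate 0 and blocks have first
   coordinate 1. As in Babai's criterion, an isomorphism phi from dev(G_F') to dev(G_F)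
   comes from an EA-equivalence as soon as the translation group T of W and its
   conjugate by phi are conjugate in the group A of those automorphisms of dev(G_F) that
   commute with translations by U, since then phi can be corrected to an affine map.
   By Sylow's theorem, it is enough to show that a conjugate T1 of T inside A such that
   T and T1 normalise each other equals T.

   Elements of such a T1 are affine maps of W, and their linear parts are unipotent:
   they give alternating maps d : V x V -> V and al : V x V -> U and linear maps
   c : V -> V and ze : V -> U with
     F (z + d y z + c y) = F z + al y z + ze y,
   where d and c take values in the common radical K of d and al. Let y be outside K.
   If c y lies in the image of d y, then al y vanishes on the kernel of d y and, because
   derivatives of F are balanced, d y has rank at least m. Otherwise, because Walsh
   coefficients of F do not vanish, al y maps the kernel of d y onto U. For n = 6 and
   m = 2, 3 comparing ranks then leaves only d = al = 0, apart from the case m = 2 with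
   all d y of rank 2; there the level sets of derivatives of F are cosets of the
   kernels of the d y, which forces d = 0. *)

(** * Weakly closed p-subgroups *)

Section WeakClosure.
Local Open Scope group_scope.
Variables (gT : finGroupType) (p : nat).
Implicit Types A T S : {group gT}.

Definition weakly_rigid (A T : {set gT}) :=
  forall a, a \in A -> T :^ a \subset 'N(T) -> T \subset 'N(T :^ a) -> T :^ a = T.

(** Normalizers grow in p-groups: if [S] did not normalise [T], some [s] in [S] would normalise
    ['N_S(T)] without lying in it, and [T :^ s] and [T] would normalise each other. *)
Lemma weakly_rigid_normal A T S : weakly_rigid A T ->
  S \subset A -> p.-group S -> T \subset S -> S \subset 'N(T).
Proof.
move=> rigT sSA pS sTS; apply: contraT => nSN.
have sMS : 'N_S(T) \subset S by apply: subsetIl.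
have pMS : 'N_S(T) \proper S.
  by rewrite properE sMS subsetI subxx.
have := nilpotent_proper_norm (pgroup_nil pS) pMS.
case/properP=> _ [s /setIP[Ss nMs] nMs'].
have sT : T :^ s \subset 'N_S(T).
  rewrite -(normP nMs) conjSg subsetI sTS; exact: normG.
have Ts : T \subset 'N(T :^ s).
  apply: subset_trans (_ : 'N_S(T) \subset _); first by rewrite subsetI sTS normG.
  by rewrite -{1}(normP nMs) normJ conjSg subsetIr.
have eqT := rigT s (subsetP sSA s Ss) (subset_trans sT (subsetIr _ _)) Ts.
by case/negP: nMs'; rewrite inE Ss; apply/normP.
Qed.

Lemma weakly_rigid_conj A T x : weakly_rigid A T -> weakly_rigid (A :^ x) (T :^ x).
Proof.
move=> rigT a /imsetP[b Ab ->] n1 n2.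
have eJ : (T :^ x) :^ (b ^ x)%g = (T :^ b) :^ x.
  by rewrite -!conjsgM conjgE !mulgA mulgV mul1g.
move: n1 n2; rewrite eJ !normJ !conjSg => n1 n2.
by rewrite (rigT b) ?normJ.
Qed.

(* Both subgroups are normal in every Sylow subgroup containing them, and Sylow
   subgroups are conjugate. *)
Lemma weakly_rigid_fusion A T T' : p.-group T -> p.-group T' ->
  T \subset A -> T' \subset A -> weakly_rigid A T -> weakly_rigid A T' ->
  exists2 a, a \in A & T' :^ a \subset 'N(T) /\ T \subset 'N(T' :^ a).
Proof.
move=> pT pT' sTA sTA' rT rT'.
have [S sylS sTS] := Sylow_superset sTA pT.
have [S' sylS' sTS'] := Sylow_superset sTA' pT'.
have [a Aa eS] := Sylow_trans sylS' sylS.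
have [sSA pS] := (pHall_sub sylS, pHall_pgroup sylS).
have [sSA' pS'] := (pHall_sub sylS', pHall_pgroup sylS').
exists a => //; have sT'S : T' :^ a \subset S by rewrite eS conjSg.
split.
  exact: subset_trans sT'S (weakly_rigid_normal rT sSA pS sTS).
apply: subset_trans sTS _; rewrite eS normJ conjSg.
exact: weakly_rigid_normal rT' sSA' pS' sTS'.
Qed.

End WeakClosure.

(** * Translation groups *)

Section Translations.
Variable W : finZmodType.
Implicit Types (p q : W) (g : {perm W}).

Definition transl p : {perm W} := perm (@addrI W p).

Lemma translE p q : transl p q = p + q.
Proof. by rewrite permE. Qed.

Definition translations := [set transl p | p : W].

Lemma transl_in p : transl p \in translations.
Proof. exact: imset_f. Qed.

Lemma group_set_translations : group_set translations.
Proof.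
apply/group_setP; split=> [|_ _ /imsetP[p _ ->] /imsetP[q _ ->]].
  by apply/imsetP; exists 0 => //; apply/permP=> q; rewrite translE add0r perm1.
apply/imsetP; exists (q + p) => //; apply/permP=> r.
by rewrite permM !translE addrA.
Qed.
Canonical translations_group := Group group_set_translations.

Lemma card_translations : #|translations| = #|W|.
Proof.
rewrite card_imset // => p q /(congr1 (fun g : {perm W} => g 0)).
by rewrite !translE !addr0.
Qed.

Lemma norm_translations_affine g p q :
  g \in 'N(translations)%g -> g (p + q) = g p + g q - g 0.
Proof.
move=> nTg; have /imsetP[p' _ ep'] : (transl p ^ g)%g \in translations.
  by rewrite memJ_norm // transl_in.
have eg r : g (p + r) = p' + g r.
  by rewrite -(translE p' (g r)) -ep' conjgE !permM permK translE.
by rewrite -[in g p](addr0 p) !eg addrAC addrK.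
Qed.

End Translations.

(** * Bent functions: Walsh coefficients and derivatives *)

Lemma F2P (e : 'F_2) : e = 0 \/ e = 1.
Proof. by case: e => [[|[|//]] lt_e]; [left | right]; apply: val_inj. Qed.

Lemma addF2K (e : 'F_2) : e + e = 0.
Proof. by case: (F2P e) => ->; apply: val_inj. Qed.

Lemma addrv n (x : vec n) : x + x = 0.
Proof. by apply/rowP=> i; rewrite !mxE addF2K. Qed.

Lemma oppv n (x : vec n) : - x = x.
Proof. by apply/eqP; rewrite eq_sym -addr_eq0 addrv. Qed.

Lemma addvKK n (x y : vec n) : x + y + y = x.
Proof. by rewrite -addrA addrv addr0. Qed.

Lemma dotDr n (a x y : vec n) : dotF2 a (x + y) = dotF2 a x + dotF2 a y.
Proof. by rewrite /dotF2 mulmxDl mxE. Qed.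

Lemma dotDl n (a b x : vec n) : dotF2 (a + b) x = dotF2 a x + dotF2 b x.
Proof. by rewrite /dotF2 linearD mulmxDr mxE. Qed.

Lemma dotC n (a x : vec n) : dotF2 a x = dotF2 x a.
Proof.
by rewrite /dotF2 !mxE; apply: eq_bigr => i _; rewrite !mxE mulrC.
Qed.

Lemma dot0l n (x : vec n) : dotF2 0 x = 0.
Proof. by rewrite /dotF2 trmx0 mulmx0 mxE. Qed.

Lemma dot_nondegenerate n (a : vec n) : a != 0 -> exists x, dotF2 a x = 1.
Proof.
case/rV0Pn=> i ai; exists (delta_mx 0 i).
rewrite /dotF2 -rowE !mxE; case: (F2P (a 0 i)) => // ai0.
by rewrite ai0 eqxx in ai.
Qed.

Lemma sgnD (d e : 'F_2) : sgnF2 (d + e) = sgnF2 d * sgnF2 e.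
Proof. by case: (F2P d) => ->; case: (F2P e) => ->. Qed.

Lemma sum_sgn_dot n (a : vec n) :
  \sum_(x : vec n) sgnF2 (dotF2 a x) = if a == 0 then (2 ^ n)%:Z else 0.
Proof.
case: eqP => [->|/eqP/dot_nondegenerate[y ay]].
  under eq_bigr => x _ do rewrite dot0l.
  by rewrite sumr_const cardT -cardE card_mx mul1n card_Fp // -[RHS]natz.
set s := (X in X = _); have eqs : s = - s.
  rewrite {1}/s (reindex_inj (addIr y)) -sumrN; apply: eq_bigr => x _.
  by rewrite dotDr ay sgnD mulrN1.
lia.
Qed.

Lemma pow2_neq0 n : (2 ^ n)%:Z != 0.
Proof. by rewrite (eqz_nat _ 0) expn_eq0. Qed.

Section Bent.
Variables (n m : nat) (F : vec n -> vec m).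
Hypothesis bentF : bent F.

Lemma bent_walsh_neq0 a b : b != 0 -> walsh F a b != 0.
Proof.
by move=> b0; case: (bentF a b0) => ->; rewrite ?oppr_eq0 pow2_neq0.
Qed.

(** Squared Walsh coefficients do not depend on [a], so their character sum at [w] vanishes;
    expanding the squares turns it into $2^n$ times the autocorrelation. *)
Lemma bent_autocorrelation b w : b != 0 -> w != 0 ->
  \sum_(z : vec n) sgnF2 (dotF2 b (F (z + w) + F z)) = 0.
Proof.
move=> b0 w0.
have sqW a : walsh F a b * walsh F a b = (2 ^ n./2)%:Z * (2 ^ n./2)%:Z.
  by case: (bentF a b0) => ->; rewrite ?mulrNN.
have: \sum_(a : vec n) walsh F a b * walsh F a b * sgnF2 (dotF2 w a) = 0.
  under eq_bigr => a _ do rewrite sqW.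
  by rewrite -mulr_sumr sum_sgn_dot (negPf w0) mulr0.
have -> : \sum_(a : vec n) walsh F a b * walsh F a b * sgnF2 (dotF2 w a) =
   \sum_(z : vec n) sgnF2 (dotF2 b (F (z + w) + F z)) * (2 ^ n)%:Z.
  rewrite /walsh; under eq_bigr => a _.
    rewrite big_distrlr /= mulr_suml.
    under eq_bigr => x _ do rewrite mulr_suml.
    over.
  rewrite exchange_big /=; apply: eq_bigr => z _.
  (* Summing over [a] leaves only the terms with [y = z + w]. *)
  rewrite exchange_big /= (bigD1 (z + w)) //= [X in _ + X]big1 => [|y yzw]; last first.
    transitivity (sgnF2 (dotF2 b (F z + F y)) *
        \sum_(a : vec n) sgnF2 (dotF2 (z + y + w) a)).
      rewrite mulr_sumr; apply: eq_bigr => a _.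
      by rewrite -!sgnD !dotDr !dotDl (dotC z) (dotC y); congr sgnF2; ring.
    rewrite sum_sgn_dot (_ : _ == 0 = false) ?mulr0 //.
    by apply: contraNF yzw => /eqP; rewrite addrAC => /addr0_eq; rewrite oppv => ->.
  rewrite addr0 dotDr sgnD.
  transitivity (\sum_(a : vec n) sgnF2 (dotF2 b (F (z + w))) * sgnF2 (dotF2 b (F z))).
    apply: eq_bigr => a _; rewrite -!sgnD dotDr (dotC w); congr sgnF2.
    transitivity (dotF2 b (F (z + w)) + dotF2 b (F z) + (dotF2 a z + dotF2 a z)
      + (dotF2 a w + dotF2 a w)); first by ring.
    by rewrite !addF2K !addr0.
  by rewrite sumr_const cardT -cardE card_mx mul1n card_Fp // -[(2 ^ n)%:Z]natz mulr_natr.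
rewrite -mulr_suml => /eqP; rewrite mulf_eq0 => /orP[/eqP //|].
by rewrite (negPf (pow2_neq0 _)).
Qed.

(** Counting by characters: the terms with [b != 0] are autocorrelations up to sign and vanish,
    while [b = 0] contributes $2^n$. *)
Lemma bent_derivative_balanced w v : w != 0 ->
  (#|[set z | F (z + w) + F z == v]%R| * 2 ^ m = 2 ^ n)%N.
Proof.
move=> w0; apply/eqP; rewrite -eqz_nat PoszM.
have <- : \sum_(z : vec n) \sum_(b : vec m) sgnF2 (dotF2 (F (z + w) + F z + v) b)
    = #|[set z | F (z + w) + F z == v]|%:Z * (2 ^ m)%:Z.
  under eq_bigr => z _ do rewrite sum_sgn_dot.
  rewrite -big_mkcond /= sumr_const -mulr_natl natz; congr (Posz _ * _).
  rewrite -cardsE; apply: eq_card => z; rewrite !inE.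
  by rewrite -[RHS]subr_eq0 oppv.
rewrite exchange_big (bigD1 0) //= [X in _ + X]big1 ?addr0 => [|b b0].
  under eq_bigr => z _ do rewrite dotC dot0l.
  by rewrite sumr_const cardT -cardE card_mx mul1n card_Fp // natz.
under eq_bigr => z _ do rewrite dotC dotDr sgnD.
by rewrite -mulr_suml bent_autocorrelation ?mul0r.
Qed.

Lemma bent_derivative_onto w v : w != 0 -> exists z, F (z + w) + F z = v.
Proof.
move=> w0; have := bent_derivative_balanced v w0.
case: (set_0Vmem [set z | F (z + w) + F z == v]) => [->|[z]].
  by rewrite cards0 mul0n => /eqP; rewrite eq_sym expn_eq0.
by rewrite inE => /eqP; exists z.
Qed.

End Bent.

(** * Unipotent symmetries of a bent function *)

Section AdditiveMatrix.
Variables (n k : nat) (f : vec n -> vec k).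
Hypothesis fD : forall x y, f (x + y) = f x + f y.

Definition mx_of : 'M['F_2]_(n, k) := \matrix_i f (delta_mx 0 i).

Lemma additive0 : f 0 = 0.
Proof. by have := fD 0 0; rewrite addr0 addrv. Qed.

Lemma mx_ofE x : f x = x *m mx_of.
Proof.
have fZ a y : f (a *: y) = a *: f y.
  by case: (F2P a) => ->; rewrite ?scale0r ?additive0 ?scale1r.
rewrite {1}[x]row_sum_delta (big_morph f fD additive0) mulmx_sum_row.
by apply: eq_bigr => i _; rewrite fZ rowK.
Qed.

End AdditiveMatrix.

Section Twist.
Variables (n m : nat) (F : vec n -> vec m).
Variables (d : vec n -> vec n -> vec n) (al : vec n -> vec n -> vec m).
Variables (c : vec n -> vec n) (ze : vec n -> vec m).
Hypothesis bentF : bent F.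
Hypotheses (dD : forall x y z, d (x + y) z = d x z + d y z)
  (dC : forall x y, d x y = d y x) (dd : forall x, d x x = 0)
  (aD : forall x y z, al (x + y) z = al x z + al y z)
  (aC : forall x y, al x y = al y x) (aa : forall x, al x x = 0)
  (cD : forall x y, c (x + y) = c x + c y)
  (zeD : forall x y, ze (x + y) = ze x + ze y).
Hypothesis twistF : forall y z, F (z + (d y z + c y)) = F z + (al y z + ze y).
Hypotheses (d_d : forall x y z, d (d x y) z = 0)
  (al_d : forall x y z, al (d x y) z = 0)
  (d_c : forall y z, d (c y) z = 0) (al_c : forall y z, al (c y) z = 0).

Let dDr x y z : d x (y + z) = d x y + d x z.
Proof. by rewrite dC dD !(dC x). Qed.
Let aDr x y z : al x (y + z) = al x y + al x z.
Proof. by rewrite aC aD !(aC x). Qed.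
Let N y := mx_of (d y).
Let A y := mx_of (al y).
Let NE y z : z *m N y = d y z.
Proof. by rewrite -mx_ofE. Qed.
Let AE y z : z *m A y = al y z.
Proof. by rewrite -mx_ofE. Qed.
(** Flattening both matrices into one row vector makes the common radical [K] of [d] and [al] the
    kernel of a linear map. *)
Let big y : vec _ := mxvec (row_mx (N y) (A y)).
Let bigD x y : big (x + y) = big x + big y.
Proof.
rewrite /big -raddfD add_row_mx; congr (mxvec (row_mx _ _)).
  by apply/matrixP=> i j; rewrite !mxE dD mxE.
by apply/matrixP=> i j; rewrite !mxE aD mxE.
Qed.
Let K := kermx (mx_of big).

Let KP y : reflect (forall z, d y z = 0 /\ al y z = 0) (y <= K)%MS.
Proof.
rewrite sub_kermx -mx_ofE // mxvec_eq0.
apply: (iffP eqP) => [|h].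
  by rewrite -row_mx0 => /eq_row_mx[N0 A0] z; rewrite -NE -AE N0 A0 !mulmx0.
rewrite -row_mx0; congr row_mx; apply/row_matrixP=> i.
  by rewrite rowE NE row0; case: (h (delta_mx 0 i)).
by rewrite rowE AE row0; case: (h (delta_mx 0 i)).
Qed.

(** Equivalently, the map [z |-> z + (d y z + c y)] of [twistF] has a fixed point [g]. *)
Let meets_image y := exists g, c y = d y g.

Let twist_value y g : c y = d y g -> ze y = al y g.
Proof.
move=> cy; have := twistF y g; rewrite cy addrv addr0 -{1}[F g]addr0.
by move/addrI/esym/addr0_eq; rewrite oppv.
Qed.

(** Both [g] and [z + g] are fixed points, and [al y] equals [ze y] at every fixed point. *)
Let al_ker y z : meets_image y -> d y z = 0 -> al y z = 0.
Proof.
case=> g cy dz; have := @twist_value y (z + g).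
rewrite dDr dz add0r aDr -(twist_value cy) => /(_ cy).
by rewrite -{1}[ze y]add0r => /addIr.
Qed.

Let card_ker y : #|[set z | d y z == 0]| = (2 ^ (n - \rank (N y)))%N.
Proof.
transitivity #|rowg (kermx (N y))|; last by rewrite card_rowg card_Fp // mxrank_ker.
by apply: eq_card => z; rewrite !inE sub_kermx NE.
Qed.

(** Along a coset of the kernel of [d y], neither the direction of the derivative nor its value
    changes. *)
Let ker_coset_sub y z : meets_image y ->
  [set z + x | x in [set x | d y x == 0]] \subset
  [set x | F (x + (d y z + c y)) + F x == al y z + ze y].
Proof.
move=> Iy; apply/subsetP=> ? /imsetP[x]; rewrite !inE => /eqP dx ->.
have := twistF y (z + x); rewrite dDr dx addr0 aDr (al_ker Iy dx) addr0 => ->.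
by rewrite addrAC addrv add0r.
Qed.

(** A coset of the kernel lies in a level set of a derivative, which has only $2^{n-m}$ elements. *)
Let rank_large y : ~~ (y <= K)%MS -> meets_image y -> (m <= \rank (N y))%N.
Proof.
move=> Ky Iy; have [g cy] := Iy.
have [z dz] : exists z, d y z != 0.
  case: (pickP (fun z => d y z != 0)) => [z dz|d0]; first by exists z.
  case/KP: Ky => z; have /eqP dz := negbFE (d0 z).
  by rewrite dz (al_ker Iy dz).
(* At [z + g] the direction is [d y z], which is nonzero. *)
have := subset_leq_card (ker_coset_sub (z + g) Iy).
rewrite card_imset; last exact: addrI.
rewrite dDr -cy addvKK card_ker => le.
have := leq_mul le (leqnn (2 ^ m)%N); rewrite bent_derivative_balanced //.
rewrite -expnD leq_exp2l //; have := rank_leq_col (N y); lia.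
Qed.

Let rank_le y : (\rank (N y) <= \rank K)%N.
Proof.
apply/mxrankS/row_subP=> i; rewrite rowE NE.
by apply/KP=> z; rewrite d_d al_d.
Qed.

Let rank_Ky (y : vec n) : ~~ (y <= K)%MS -> (\rank K < \rank (K + y)%MS)%N.
Proof.
move=> Ky; apply: rank_ltmx; rewrite ltmxE addsmxSl /=.
by apply: contra Ky; apply: submx_trans; apply: addsmxSr.
Qed.

Let Ky_ker (y : vec n) : (K + y <= kermx (N y) :&: kermx (A y))%MS.
Proof.
rewrite addsmx_sub !sub_capmx !sub_kermx NE AE dd aa !eqxx !andbT.
apply/andP; split; apply/eqP/row_matrixP=> i; rewrite row_mul row0 (NE, AE) 1?dC 1?aC.
  by have /KP/(_ y)[] : (row i K <= K)%MS by apply: row_sub.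
by have /KP/(_ y)[] : (row i K <= K)%MS by apply: row_sub.
Qed.

Let rank_ker (y : vec n) : ~~ (y <= K)%MS -> (\rank (N y) + \rank K < n)%N.
Proof.
move=> /rank_Ky lt; have := mxrankS (submx_trans (Ky_ker y) (capmxSl _ _)).
by rewrite mxrank_ker; have := rank_leq_col (N y); lia.
Qed.

(* The function [b.F + a] changes by this constant under the involution
   [z |-> z + d y z + c y]; if the constant were 1, the Walsh coefficient of [F] at
   [a] would be its own opposite. *)
Let walsh_shift y (b : vec m) (a : 'cV_n) : b != 0 ->
  (forall z, dotF2 a^T (d y z) = dotF2 b (al y z)) ->
  dotF2 b (ze y) + dotF2 a^T (c y) = 0.
Proof.
move=> b0 ab; set e := _ + _; case: (F2P e) => // e1.
pose s z := z + (d y z + c y).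
have sK : involutive s.
  move=> z; rewrite /s 2!dDr [d y (d y z)]dC d_d [d y (c y)]dC d_c !addr0.
  by rewrite addvKK.
have := bent_walsh_neq0 bentF a^T b0; rewrite /walsh.
set W := \sum_x _; have eW : W = - W; last by move: eW; lia.
rewrite {1}/W (reindex_inj (inv_inj sK)) -sumrN; apply: eq_bigr => z _.
rewrite -[RHS]mulN1r -[-1]/(sgnF2 1) -e1 -sgnD /s twistF !dotDr ab /e; congr sgnF2.
transitivity (dotF2 b (ze y) + dotF2 a^T (c y) + (dotF2 b (F z) + dotF2 a^T z)
  + (dotF2 b (al y z) + dotF2 b (al y z))); first by ring.
by rewrite addF2K addr0.
Qed.

Let col_mul k p q (B : 'M['F_2]_(k, p)) (D : 'M_(p, q)) j :
  B *m col j D = col j (B *m D).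
Proof. by rewrite !colE mulmxA. Qed.

(** The functional on the kernel of [d y] being zero, it factors as [a] after [d y], where [a] may
    be altered by any functional killing the image of [d y]. By [walsh_shift] each of these kills
    [c y] too. *)
Let meets_image_of_functional y b : b != 0 ->
  (forall z, d y z = 0 -> dotF2 b (al y z) = 0) -> meets_image y.
Proof.
move=> b0 ker_b; pose be := A y *m b^T.
have dotE (a : 'cV['F_2]_n) z : dotF2 a^T z = (z *m a) 0 0 by rewrite /dotF2 trmxK.
have ker_be : kermx (N y) *m be = 0.
  apply/row_matrixP=> i; rewrite row_mul row0; apply/rowP=> j.
  rewrite ord1 mulmxA AE [RHS]mxE; apply: ker_b.
  by rewrite -NE -row_mul mulmx_ker row0.
have [a Na] : exists a, N y *m a = be.
  exists (pinvmx (N y) *m be); apply/eqP.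
  rewrite -subr_eq0 -{2}[be]mul1mx mulmxA -mulmxBl.
  have /submxP[X ->] : (N y *m pinvmx (N y) - 1%:M <= kermx (N y))%MS.
    by rewrite sub_kermx mulmxBl mul1mx mulmxKpV ?subrr.
  by rewrite -mulmxA ker_be mulmx0.
have sol a' : N y *m a' = be -> dotF2 b (ze y) + dotF2 a'^T (c y) = 0.
  move=> Na'; apply: walsh_shift => // z.
  by rewrite dotE -NE -mulmxA Na' mulmxA AE.
suff /submxP[g cy] : (c y <= N y)%MS by exists g; rewrite cy NE.
rewrite submxE; apply/eqP/rowP=> j; rewrite [RHS]mxE.
have -> : (c y *m cokermx (N y)) 0 j = dotF2 (col j (cokermx (N y)))^T (c y).
  by rewrite dotE col_mul [RHS]mxE.
have := sol (a + col j (cokermx (N y))).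
rewrite mulmxDr col_mul mulmx_coker linear0 addr0.
move/(_ Na); rewrite linearD dotDl addrA sol // add0r //.
Qed.

(** If [al y] did not map the kernel of [d y] onto the target, a nonzero functional would kill the
    image, against [meets_image_of_functional]; rank-nullity does the rest. *)
Let rank_avoid y : ~~ (y <= K)%MS -> ~ meets_image y ->
  (\rank (N y) + m + \rank (kermx (N y) :&: kermx (A y)) = n)%N.
Proof.
move=> Ky nI; pose Z := kermx (N y).
have full : row_full (Z *m A y).
  rewrite -cokermx_eq0; apply: contraT => /matrix0Pn[i [j ij]].
  case: nI; apply: (@meets_image_of_functional y (col j (cokermx (Z *m A y)))^T).
    by apply/rV0Pn; exists i; rewrite mxE mxE.
  move=> z dz; have /submxP[u zu] : (z <= Z)%MS by rewrite sub_kermx NE dz.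
  rewrite /dotF2 trmxK -AE zu -(mulmxA u) -mulmxA col_mul mulmx_coker linear0.
  by rewrite mulmx0 mxE.
have := mxrank_mul_ker Z (A y); rewrite (eqnP full) mxrank_ker.
have := rank_leq_col (N y); rewrite -/Z; lia.
Qed.

Let rank_avoid_le y : ~~ (y <= K)%MS -> ~ meets_image y ->
  (\rank (N y) + \rank K + m < n)%N.
Proof.
move=> Ky nI; have := rank_avoid Ky nI.
have := mxrankS (Ky_ker y); have := rank_Ky Ky; lia.
Qed.

(* A level set of a derivative of [F] has [2 ^ (n - m)] elements, so it is a single
   coset of the kernel of [d y1]. *)
Let level_coset y1 y2 z1 z2 x :
  meets_image y1 -> meets_image y2 -> \rank (N y1) = m -> d y2 x = 0 ->
  d y1 z1 + c y1 = d y2 z2 + c y2 -> al y1 z1 + ze y1 = al y2 z2 + ze y2 ->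
  d y1 z1 + c y1 != 0 -> d y1 (z1 + (z2 + x)) = 0.
Proof.
move=> I1 I2 r1 dx ew ev w0.
have kx : x \in [set x | d y2 x == 0] by rewrite inE dx.
have := subsetP (ker_coset_sub z2 I2) _ (imset_f (+%R z2) kx).
rewrite -ew -ev.
have /eqP <- : [set z1 + x | x in [set x | d y1 x == 0]] ==
    [set x | F (x + (d y1 z1 + c y1)) + F x == al y1 z1 + ze y1].
  rewrite eqEcard ker_coset_sub //= card_imset; last exact: addrI.
  rewrite card_ker r1 -(leq_pmul2r (expn_gt0 2 m)) bent_derivative_balanced //.
  by rewrite -expnD leq_exp2l //; have := rank_leq_col (N y1); lia.
by case/imsetP=> x1; rewrite inE => /eqP dx1 ->; rewrite addrA addrv add0r.
Qed.

(** A witness [g] for [y1 + y2] gives [y1] and [y2] equal directions and values at [g]. If the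
    direction is nonzero, the level set is [g] plus the kernel of [d y1], and it contains
    [g + y2]. *)
Let isotropic y1 y2 : meets_image y1 -> meets_image y2 -> meets_image (y1 + y2) ->
  \rank (N y1) = m -> d y1 y2 = 0.
Proof.
move=> I1 I2 [g e3] r1.
have ew : d y1 g + c y1 = d y2 g + c y2.
  by apply/eqP; rewrite -subr_eq0 oppv addrACA -dD -cD e3 addrv.
have ev : al y1 g + ze y1 = al y2 g + ze y2.
  by apply/eqP; rewrite -subr_eq0 oppv addrACA -aD -zeD (twist_value e3) addrv.
have [w0|w0] := eqVneq (d y1 g + c y1) 0; last first.
  have := level_coset I1 I2 r1 (dd y2) ew ev w0.
  by rewrite addrA addrv add0r.
have e1 : c y1 = d y1 g by rewrite -[RHS]oppv (addr0_eq w0).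
have e2 : c y2 = d y2 g by rewrite -[RHS]oppv (addr0_eq (etrans (esym ew) w0)).
have [//|dn0] := eqVneq (d y1 y2) 0.
(* Now [g] is a fixed point for both; moving to [g + y2] and [g + y1] makes both directions equal to
   [d y1 y2], assumed nonzero. *)
have := @level_coset y1 y2 (g + y2) (g + y1) 0 I1 I2 r1.
rewrite !dDr !aDr -e1 -e2 -(twist_value e1) -(twist_value e2) (dC y2 y1) (aC y2 y1) dd.
rewrite ![_ + d y1 y2]addrC ![_ + al y1 y2]addrC !addvKK.
have -> : d y2 0 = 0 by have := dDr y2 0 0; rewrite addr0 addrv.
have -> : d y1 0 = 0 by have := dDr y1 0 0; rewrite addr0 addrv.
by rewrite !addr0 addvKK; apply.
Qed.

(** * Rank comparison in dimension 6 *)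

Hypothesis n6 : n = 6.
Hypothesis m23 : ((m == 2) || (m == 3))%N.

Let exists_notin k (B : 'M['F_2]_(k, n)) :
  (\rank B < n)%N -> exists y : vec n, ~~ (y <= B)%MS.
Proof.
move=> lt; have /row_subPn[i iB] : ~~ (1%:M <= B)%MS.
  by apply: contraL lt => /mxrankS; rewrite mxrank1 -leqNgt.
by exists (row i 1%:M).
Qed.

Let notin_hits y : ~~ (y <= K)%MS -> meets_image y ->
  [/\ m <= \rank (N y), \rank (N y) <= \rank K & \rank (N y) + \rank K < 6]%N.
Proof.
move=> Ky Iy; have := rank_ker Ky; rewrite rank_large // rank_le => lt.
by split=> //; lia.
Qed.

Let P := kermx (mx_of c).
Let PP y : (y <= P)%MS = (c y == 0).
Proof. by rewrite sub_kermx -mx_ofE. Qed.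

Let P_meets y : (y <= P)%MS -> meets_image y.
Proof. by rewrite PP => /eqP c0; exists y; rewrite dd. Qed.

Let rank_P : (6 <= \rank P + \rank K)%N.
Proof.
rewrite mxrank_ker; have : (\rank (mx_of c) <= \rank K)%N.
  apply/mxrankS/row_subP=> i; rewrite rowE -mx_ofE //.
  by apply/KP=> z; rewrite d_c al_c.
by have := rank_leq_col (mx_of c); lia.
Qed.

Let d_rank0 y z : \rank (N y) = 0%N -> d y z = 0.
Proof. by move/eqP; rewrite mxrank_eq0 -NE => /eqP->; rewrite mulmx0. Qed.

(** Comparing ranks gives every [d y] with [y] outside [K] rank 2, and then [isotropic] makes [d y0]
    vanish. *)
Let not_all_meet (y0 : vec n) : m = 2 -> ~~ (y0 <= K)%MS ->
  (forall y : vec n, ~~ (y <= K)%MS -> meets_image y) -> False.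
Proof.
move=> m2 Ky0 allI.
have r2 (y : vec n) : ~~ (y <= K)%MS -> \rank (N y) = m.
  by move=> Ky; case: (notin_hits Ky (allI y Ky)); lia.
suff d0 (z : vec n) : d y0 z = 0.
  have := r2 _ Ky0; suff -> : N y0 = 0 by rewrite mxrank0 m2.
  by apply/row_matrixP=> i; rewrite rowE NE row0 d0.
have [Kz|Kz] := boolP (z <= K)%MS; first by case: (elimT (KP _) Kz y0); rewrite dC.
have [Kyz|Kyz] := boolP ((y0 + z)%R <= K)%MS.
  by case: (elimT (KP _) Kyz y0); rewrite dD dd add0r dC.
by apply: isotropic; auto.
Qed.

(** Here [K] has rank 3, and [al] induces an alternating map from the 3-dimensional quotient by [K]
    to a plane, nonzero on independent pairs. But the exterior square of a 3-space has dimension 3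
    and only decomposable elements, so some independent pair is killed. *)
Let not_all_avoid (y0 : vec n) : m = 2 -> ~~ (y0 <= K)%MS ->
  (forall y : vec n, ~~ (y <= K)%MS -> ~ meets_image y) -> False.
Proof.
move=> m2 Ky0 allA.
have rK : \rank K = 3%N.
  have sPK : (P <= K)%MS.
    apply/row_subP=> i; apply: contraT => Ki.
    by case: (allA _ Ki); apply: P_meets; rewrite row_sub.
  have := mxrankS sPK; have := rank_P; have := rank_avoid_le Ky0 (allA _ Ky0); lia.
have r0 (y : vec n) : ~~ (y <= K)%MS -> \rank (N y) = 0%N.
  by move=> Ky; have := rank_avoid_le Ky (allA _ Ky); lia.
have al0 (y z : vec n) : ~~ (y <= K)%MS -> al y z = 0 -> (z <= K + y)%MS.
  move=> Ky alz.
  have -> : (K + y :=: kermx (N y) :&: kermx (A y))%MS.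
    apply/eqmxP; rewrite -(geq_leqif (mxrank_leqif_eq (Ky_ker y))).
    have := rank_avoid Ky (allA _ Ky); have := rank_Ky Ky; rewrite r0 //; lia.
  by rewrite sub_capmx !sub_kermx NE AE alz d_rank0 ?r0 ?eqxx.
have rle1 k (B : 'M['F_2]_(k, n)) (y : vec n) : (\rank (B + y)%MS <= \rank B + 1)%N.
  by apply: leq_trans (mxrank_adds_leqif B y) _; rewrite leq_add2l rank_rV leq_b1.
have [z Kz] : exists z : vec n, ~~ (z <= K + y0)%MS.
  by apply: exists_notin; have := rle1 _ K y0; lia.
have [x Kx] : exists x : vec n, ~~ (x <= K + y0 + z)%MS.
  by apply: exists_notin; have := rle1 _ K y0; have := rle1 _ (K + y0)%MS z; lia.
(* Three vectors in a plane are dependent; [u] holds the coefficients of a relation. *)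
have /rowV0Pn[u /sub_kermxP uM u0] :
    kermx (col_mx (al y0 z) (col_mx (al y0 x) (al z x))) != 0.
  rewrite -mxrank_eq0 mxrank_ker -lt0n subn_gt0.
  by apply: leq_ltn_trans (rank_leq_col _) _; rewrite m2.
have [p [q [t [eu lin]]]] : exists p q t : 'F_2, (u = row_mx p%:M (row_mx q%:M t%:M)) /\
    p *: al y0 z + (q *: al y0 x + t *: al z x) = 0.
  exists (lsubmx u 0 0), (lsubmx (rsubmx u) 0 0), (rsubmx (rsubmx u) 0 0).
  rewrite -!mx11_scalar !hsubmxK; split=> //.
  by rewrite -!mul_scalar_mx -!mx11_scalar -!mul_row_col !hsubmxK.
have Kzy q' : ~~ ((z + q' *: y0)%R <= K)%MS.
  apply: contra Kz => Kzy; rewrite -[z](addrK (q' *: y0)).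
  by rewrite addmx_sub ?(submx_trans Kzy) ?addsmxSl // oppv scalemx_sub ?addsmxSr.
have al00 w : al 0 w = 0 by have := aD 0 0 w; rewrite addr0 addrv.
have alZ a v w : al v (a *: w) = a *: al v w.
  by case: (F2P a) => ->; rewrite ?scale0r ?scale1r // aC al00.
(* The bivector of the relation is [z + q *: y0] wedge [x + p *: y0] if [t] is 1, and [y0] wedge
   [p *: z + q *: x] if [t] is 0. *)
case: (F2P t) lin eu => -> lin eu; last first.
  have /al0-/(_ (Kzy q)) xK : al (z + q *: y0) (x + p *: y0) = 0.
    rewrite aD !aDr !alZ ![al (q *: _) _]aC !alZ aa !scaler0 addr0.
    by rewrite (aC z y0) (aC x y0) -[RHS]lin scale1r -addrA addrC -addrA.
  case/negP: Kx; rewrite -[x](addrK (p *: y0)) oppv addmx_sub //.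
    apply: submx_trans xK _; rewrite addsmx_sub -addsmxA addsmxSl /=.
    rewrite addmx_sub ?scalemx_sub //; first by rewrite addsmxA addsmxSr.
    by rewrite (submx_trans _ (addsmxSr _ _)) ?addsmxSl.
  by rewrite scalemx_sub // (submx_trans _ (addsmxSl _ _)) ?addsmxSr.
have /al0-/(_ Ky0) zxK : al y0 (p *: z + q *: x) = 0.
  by rewrite aDr !alZ -[RHS]lin scale0r addr0.
case: (F2P q) zxK eu => -> zxK eu.
  case: (F2P p) zxK eu => -> zxK eu; last first.
    by case/negP: Kz; move: zxK; rewrite scale1r scale0r addr0.
  by case/negP: u0; rewrite eu !raddf0 !row_mx0.
case/negP: Kx; rewrite -[x](addKr (p *: z)) oppv addmx_sub ?scalemx_sub ?addsmxSr //.
by move: zxK; rewrite scale1r => /submx_trans-> //; rewrite addsmxSl.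
Qed.

Lemma twist_trivial y z : d y z = 0 /\ al y z = 0.
Proof.
suff Ky : (y <= K)%MS by apply: (elimT (KP y) Ky).
apply: contraT => Ky0.
have Ia_lt : m = 2 \/ m = 3 by case/orP: m23 => /eqP; auto.
case: Ia_lt => [m2|m3]; last first.
  (* For [m = 3], meeting the image would need two ranks of at least 3 with sum below 6. So [P] lies
     in [K], whose rank is then too large for [rank_avoid_le]. *)
  have allA (x : vec n) : ~~ (x <= K)%MS -> ~ meets_image x.
    by move=> Kx Ix; case: (notin_hits Kx Ix); lia.
  have sPK : (P <= K)%MS.
    apply/row_subP=> i; apply: contraT => Ki.
    by case: (allA _ Ki); apply: P_meets; rewrite row_sub.
  have := mxrankS sPK; have := rank_P; have := rank_avoid_le Ky0 (allA _ Ky0); lia.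
pose meetb (x : vec n) := [exists g, c x == d x g].
have meetP x : reflect (meets_image x) (meetb x).
  by apply: (iffP existsP) => -[g /eqP]; exists g => //; apply/eqP.
case: (pickP (fun x : vec n => ~~ (x <= K)%MS && meetb x))
  => [y1 /andP[Ky1 /meetP I1]|no].
  case: (pickP (fun x : vec n => ~~ (x <= K)%MS && ~~ meetb x))
    => [y2 /andP[Ky2 /meetP I2]|no].
    have [r1 r1' r1''] := notin_hits Ky1 I1; have r2 := rank_avoid_le Ky2 I2.
    have [rK|rK] : \rank K = 2%N \/ \rank K = 3%N by lia.
      (* Here [P] has rank at least 4 and is the kernel of [d x] for each [x] in [P] outside [K]. So
         the kernel of [d y2] meets [P] inside [K], which is impossible when [d y2] has rank at most
         1. *)
      have rNP (x : vec n) : (x <= P)%MS -> ~~ (x <= K)%MS -> \rank (N x) = m.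
        by move=> Px Kx; case: (notin_hits Kx (P_meets Px)); lia.
      have dP0 (x1 x2 : vec n) :
          (x1 <= P)%MS -> (x2 <= P)%MS -> ~~ (x1 <= K)%MS -> d x1 x2 = 0.
        move=> P1 P2 K1; apply: isotropic; rewrite ?rNP //; apply: P_meets => //.
        by rewrite addmx_sub.
      have kerP (x z' : vec n) :
          (x <= P)%MS -> ~~ (x <= K)%MS -> d x z' = 0 -> (z' <= P)%MS.
        move=> Px Kx dxz; have sP : (P <= kermx (N x))%MS.
          by apply/row_subP=> i; rewrite sub_kermx NE dP0 // row_sub.
        have : (kermx (N x) <= P)%MS.
          rewrite -(geq_leqif (mxrank_leqif_sup sP)) mxrank_ker rNP //.
          by have := rank_P; lia.
        by apply: submx_trans; rewrite sub_kermx NE dxz.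
      have Py2 : ~~ (y2 <= P)%MS by apply/negP=> /P_meets.
      have := mxrank_mul_ker P (N y2).
      have : (P :&: kermx (N y2) <= K)%MS.
        apply/row_subP=> i; set x := row i _; apply: contraT => Kx.
        have : (x <= P :&: kermx (N y2))%MS by rewrite row_sub.
        rewrite sub_capmx sub_kermx NE => /andP[Px /eqP dx].
        by case/negP: Py2; apply: (kerP x) => //; rewrite dC.
      move/mxrankS; have := mxrankM_maxr P (N y2); have := rank_P; lia.
    (* With [K] of rank 3, [d y2] is zero, so [y2] lies in the kernel of [d y1], which is [K + y1];
       this would make [d y1] zero. *)
    have d20 z' : d y2 z' = 0 by apply: d_rank0; lia.
    have : (y2 <= K + y1)%MS.
      have sK : (K + y1 <= kermx (N y1))%MS := submx_trans (Ky_ker y1) (capmxSl _ _).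
      have : (kermx (N y1) <= K + y1)%MS.
        rewrite -(geq_leqif (mxrank_leqif_sup sK)) mxrank_ker.
        by have := rank_Ky Ky1; lia.
      by apply: submx_trans; rewrite sub_kermx NE dC d20.
    case/sub_addsmxP=> -[u v] /= ey2.
    have d1 z' : d y1 z' = 0.
      have uK : (u *m K <= K)%MS by rewrite submxMl.
      have := d20 z'; rewrite ey2 dD (elimT (KP _) uK z').1 add0r.
      rewrite [v]mx11_scalar mul_scalar_mx.
      case: (F2P (v 0 0)) => [v0|->]; last by rewrite scale1r.
      by case/negP: Ky2; rewrite ey2 [v]mx11_scalar v0 raddf0 mul0mx addr0.
    have := r1; suff -> : N y1 = 0 by rewrite mxrank0 m2.
    by apply/row_matrixP=> i; rewrite rowE NE row0 d1.
  exfalso; apply: (not_all_meet m2 Ky0) => x Kx; apply/meetP.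
  by have := no x; rewrite Kx => /negbFE.
exfalso; apply: (not_all_avoid m2 Ky0) => x Kx /meetP.
by have := no x; rewrite Kx /= => ->.
Qed.

End Twist.

(** * The lifted graph and its regular elementary abelian groups *)

HB.instance Definition _ (A B : finZmodType) := Finite.on (A * B)%type.

Section LiftedGraph.
Variables n m : nat.
Notation W := ('F_2 * vec n * vec m)%type.
Implicit Types (p q : W) (F : vec n -> vec m).

Definition base : W := (1, 0, 0).
Definition horizontal (y : vec n) : W := (0, y, 0).
Definition vertical (t : vec m) : W := (0, 0, t).
Definition lifted_graph F : {set W} := [set p | (p.1.1 == 1) && (p.2 == F p.1.2)].

Lemma ambient_ext p q : p.1.1 = q.1.1 -> p.1.2 = q.1.2 -> p.2 = q.2 -> p = q.
Proof. by case: p q => [[e y] t] [[e' y'] t'] /= -> -> ->. Qed.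

Lemma addW p : p + p = 0.
Proof. by apply: ambient_ext; rewrite /= ?addF2K ?addrv. Qed.

Lemma oppW p : - p = p.
Proof. by apply/eqP; rewrite eq_sym -addr_eq0 addW. Qed.

Lemma addWKK p q : p + q + q = p.
Proof. by rewrite -addrA addW addr0. Qed.

Lemma horizontalD y z : horizontal (y + z) = horizontal y + horizontal z.
Proof. by apply: ambient_ext; rewrite /= ?addr0. Qed.

Lemma verticalD s t : vertical (s + t) = vertical s + vertical t.
Proof. by apply: ambient_ext; rewrite /= ?addr0. Qed.

Lemma lifted_graphP F p :
  reflect (exists y, p = base + horizontal y + vertical (F y)) (p \in lifted_graph F).
Proof.
rewrite inE; case: p => [[e y] t] /=.
apply: (iffP andP) => [[/eqP-> /eqP->]|[z [-> -> ->]]].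
  by exists y; apply: ambient_ext; rewrite /= ?addr0 ?add0r.
by rewrite /= !addr0 !add0r.
Qed.

Lemma split_W p : exists2 h : W, h = 0 \/ h = base &
  p = h + horizontal p.1.2 + vertical p.2.
Proof.
case: p => [[e y] t] /=; exists (e, 0, 0).
  by case: (F2P e) => ->; [left | right].
by apply: ambient_ext; rewrite /= ?addr0 ?add0r.
Qed.

(** Elements may exchange points and blocks, so that all translations of [W] belong to the group. *)
Definition graph_auts F : {set {perm W}} :=
  [set g : {perm W} |
    [forall p, forall q, (g p + g q \in lifted_graph F) == (p + q \in lifted_graph F)]
     && [forall p, forall s, g (p + vertical s) == g p + vertical s]].

Lemma graph_autsP F (g : {perm W}) :
  reflect ((forall p q, (g p + g q \in lifted_graph F) = (p + q \in lifted_graph F))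
     /\ (forall p s, g (p + vertical s) = g p + vertical s)) (g \in graph_auts F).
Proof.
rewrite inE; apply: (iffP andP) => [[h1 h2]|[h1 h2]].
  split=> p q; apply/eqP; first by move/forallP/(_ p)/forallP/(_ q): h1.
  by move/forallP/(_ p)/forallP/(_ q): h2.
by split; apply/forallP=> p; apply/forallP=> q; apply/eqP.
Qed.

Lemma group_set_graph_auts F : group_set (graph_auts F).
Proof.
apply/group_setP; split=> [|g h /graph_autsP[g1 g2] /graph_autsP[h1 h2]].
  by apply/graph_autsP; split=> p q; rewrite !perm1.
by apply/graph_autsP; split=> p q; rewrite !permM ?h1 ?g1 ?g2 ?h2.
Qed.
Canonical graph_auts_group F := Group (group_set_graph_auts F).

Lemma translations_sub_graph_auts F : translations W \subset graph_auts F.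
Proof.
apply/subsetP=> _ /imsetP[r _ ->]; apply/graph_autsP; split=> p q.
  by rewrite !translE addrACA addW add0r.
by rewrite !translE addrA.
Qed.

End LiftedGraph.

Section Rigidity.
Variables (m : nat) (F : vec 6 -> vec m).
Notation W := ('F_2 * vec 6 * vec m)%type.
Variable T1 : {group {perm W}}.
Notation T := (translations W).
Hypotheses (m23 : ((m == 2) || (m == 3))%N) (bentF : bent F).
Hypotheses (T1_auts : T1 \subset graph_auts F) (T1_abelian : abelian T1)
  (T1_inv : forall g, g \in T1 -> (g * g = 1)%g)
  (T1_trans : forall p : W, exists2 g : {perm W}, g \in T1 & g 0 = p)
  (T1_norm : T1 \subset 'N(T)%g) (norm_T1 : T \subset 'N(T1)%g).

(* [g p] is the element of [T1] sending 0 to [p], and [D p] is its linear part minus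
   the identity. Commutators of [T1] with translations lie in the abelian group [T1],
   whence [D (D p q) = 0]. *)
Lemma rigid_subgroup : T1 \subset T.
Proof.
have [g Tg g0] := fin_all_exists2 T1_trans.
have aff h x y : h \in T1 -> h (x + y) = h x + h y + h 0.
  by move/(subsetP T1_norm)/norm_translations_affine->; rewrite oppW addrAC.
have comm h k x : h \in T1 -> k \in T1 -> h (k x) = k (h x).
  by move=> Th Tk; rewrite -!permM (centsP T1_abelian).
have regular h k : h \in T1 -> k \in T1 -> h 0 = k 0 -> h = k.
  move=> Th Tk e0; apply/permP=> x; rewrite -[x in h x]g0 -[x in k x]g0.
  by rewrite !(comm _ (g x)) // e0.
have gK h x : h \in T1 -> h (h x) = x by move=> Th; rewrite -permM T1_inv ?perm1.
pose D p q := g p q + p + q.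
have DC p q : D p q = D q p.
  by have := comm (g p) (g q) 0 (Tg p) (Tg q); rewrite !g0 /D addrAC => ->.
have Dpp p : D p p = 0.
  by have := gK (g p) 0 (Tg p); rewrite g0 /D addWKK.
have Dr p x y : D p (x + y) = D p x + D p y.
  by rewrite /D aff // g0 addWKK [RHS]addrACA [in RHS](addrACA (g p x)) addW addr0.
(* Since [g p] is an involution, the product below is its commutator with [transl q]. *)
have translD p q : transl (D p q) \in T1.
  have -> : transl (D p q) = (g p * (g p ^ transl q))%g.
    apply/permP=> x; rewrite permM conjgE !permM translE.
    have -> : ((transl q)^-1 (g p x))%g = q + g p x.
      by apply: (canLR (permK _)); rewrite translE addrA addW add0r.
    by rewrite translE aff // gK // g0 /D [RHS]addrC (addrAC _ x p) [RHS]addrAC.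
  by rewrite groupM ?memJ_norm // (subsetP norm_T1) // transl_in.
have DD p q r : D (D p q) r = 0.
  have -> : D (D p q) r = transl (D p q) r + D p q + r.
    by rewrite /D (regular (g (D p q)) (transl (D p q))) // ?g0 translE ?addr0.
  by rewrite translE addrAC addWKK addW.
have Dl x y p : D (x + y) p = D x p + D y p by rewrite DC Dr !(DC p).
have D0 p : D p 0 = 0 by rewrite /D g0 addr0 addW.
have Dv p t : D p (vertical _ t) = 0.
  have /graph_autsP[_ gv] := subsetP T1_auts _ (Tg p).
  by rewrite /D -[vertical 6 t]add0r gv g0 add0r addrAC addWKK addW.
have DF p x : x \in lifted_graph F -> x + D p x \in lifted_graph F.
  have /graph_autsP[gF _] := subsetP T1_auts _ (Tg p).
  move=> Fx; have -> : x + D p x = g p x + g p 0 by rewrite g0 /D addrC addWKK.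
  by rewrite gF addr0.
pose h := @horizontal 6 m; pose b := base 6 m.
have D1 p y : (D p (b + h y)).1.1 = 0.
  have : b + h y + vertical _ (F y) \in lifted_graph F by apply/lifted_graphP; exists y.
  move/(DF p); rewrite Dr Dv addr0 inE => /andP[/eqP e _].
  by apply: (@addrI 'F_2 1); rewrite addr0 -[RHS]e /= !addr0.
have h0 : h 0 = 0 by apply: ambient_ext.
have Db1 p : (D p b).1.1 = 0 by rewrite -(D1 p 0) h0 addr0.
have Dh1 p y : (D p (h y)).1.1 = 0.
  have : (D p b).1.1 + (D p (h y)).1.1 = 0 by rewrite -(D1 p y) Dr.
  by rewrite Db1 add0r.
pose d y z := (D (h y) (h z)).1.2; pose al y z := (D (h y) (h z)).2.
pose c y := (D (h y) b).1.2; pose ze y := (D (h y) b).2.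
have Dhh y z : D (h y) (h z) = h (d y z) + vertical _ (al y z).
  apply: ambient_ext; [rewrite Dh1 | | exact: esym (add0r _)]; exact: esym (addr0 _).
have Dhb y : D (h y) b = h (c y) + vertical _ (ze y).
  apply: ambient_ext; [rewrite Db1 | | exact: esym (add0r _)]; exact: esym (addr0 _).
have hD x y : h (x + y) = h x + h y by apply: horizontalD.
have dd_al x y q : D (h (d x y)) q = 0.
  by have := DD (h x) (h y) q; rewrite Dhh Dl (DC (vertical _ _)) Dv addr0.
have dc_al x q : D (h (c x)) q = 0.
  by have := DD (h x) b q; rewrite Dhb Dl (DC (vertical _ _)) Dv addr0.
have twistF y z : F (z + (d y z + c y)) = F z + (al y z + ze y).
  have : b + h z + vertical _ (F z) \in lifted_graph F by apply/lifted_graphP; exists z.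
  move/(DF (h y)); rewrite !Dr Dv addr0 Dhh Dhb inE => /andP[_ /eqP].
  by rewrite /= !add0r !addr0 (addrC (c y)) (addrC (ze y)).
have triv y z : d y z = 0 /\ al y z = 0.
  apply: (twist_trivial (F := F) (c := c) (ze := ze)) => //.
  - by move=> u v w; rewrite /d hD Dl.
  - by move=> u v; rewrite /d DC.
  - by move=> u; rewrite /d Dpp.
  - by move=> u v w; rewrite /al hD Dl.
  - by move=> u v; rewrite /al DC.
  - by move=> u; rewrite /al Dpp.
  - by move=> u v; rewrite /c hD Dl.
  - by move=> u v; rewrite /ze hD Dl.
  - by move=> u v w; rewrite /d dd_al.
  - by move=> u v w; rewrite /al dd_al.
  - by move=> u v; rewrite /d dc_al.
  - by move=> u v; rewrite /al dc_al.
(* Otherwise the derivative of [F] in direction [c y] would be constant. *)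
have c0 y : c y = 0.
  apply/eqP/negPn/negP=> cy.
  have Fc z : F (z + c y) + F z = ze y.
    have := twistF y z; have [-> ->] := triv y z; rewrite !add0r => ->.
    by rewrite addrAC addrv add0r.
  have [z] := bent_derivative_onto bentF (ze y + const_mx 1) cy.
  rewrite Fc => e; have := addrI _ (etrans (addr0 _) e) => /rowP.
  have m0 : (0 < m)%N by case/orP: m23 => /eqP->.
  by move/(_ (Ordinal m0)); rewrite !mxE.
have ze0 y : ze y = 0.
  have := twistF y 0; have [-> ->] := triv y 0; rewrite c0 !add0r.
  by move=> e; apply: (addrI (F 0)); apply: etrans (esym e) (esym (addr0 _)).
have v0 : vertical 6 0 = 0 :> W by apply: ambient_ext.
have Dtriv p q : D p q = 0.
  have [hp ep ->] := split_W p; have [hq eq ->] := split_W q.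
  rewrite !(Dl, Dr) !Dv !(DC (vertical _ _)) !Dv !addr0 Dhh.
  have [-> ->] := triv p.1.2 q.1.2; rewrite h0 v0 !addr0.
  have Db y : D b (h y) = 0 by rewrite DC Dhb c0 ze0 h0 v0 addr0.
  have Dh y : D (h y) b = 0 by rewrite DC.
  have D0l r : D 0 r = 0 by rewrite DC D0.
  by case: ep => ->; case: eq => ->; rewrite ?D0 ?D0l ?Db ?Dh ?Dpp ?addr0.
apply/subsetP=> k Tk; apply/imsetP; exists (k 0) => //.
rewrite (regular k _ Tk (Tg (k 0))) ?g0 //; apply/permP=> q; rewrite translE.
by have := Dtriv (k 0) q; rewrite /D -addrA => /addr0_eq; rewrite oppW.
Qed.
End Rigidity.

(** * From graph isomorphisms to EA-equivalence *)

Section Frames.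
Variables (m : nat).
Notation W := ('F_2 * vec 6 * vec m)%type.
Notation T := (translations W).
Notation T_group := (translations_group W).
Implicit Types (F : vec 6 -> vec m) (phi : {perm W}).
Hypothesis m23 : ((m == 2) || (m == 3))%N.

(** Vertical translations need only be permuted, through [M]; this suffices to conjugate one
    automorphism group onto the other. *)
Definition graph_iso F F' phi :=
  (forall p q, (phi p + phi q \in lifted_graph F) = (p + q \in lifted_graph F')) /\
  exists2 M : vec m -> vec m, injective M &
    forall p s, phi (p + vertical 6 s) = phi p + vertical 6 (M s).

Lemma graph_iso_inv F F' phi : graph_iso F F' phi -> graph_iso F' F phi^-1%g.
Proof.
case=> adj [M injM phiM]; split=> [p q|].
  by rewrite -[p in RHS](permKV phi) -[q in RHS](permKV phi) adj.
exists (invF injM) => [|p s]; first exact: can_inj (f_invF injM).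
by apply: (canLR (permK phi)); rewrite phiM permKV f_invF.
Qed.

Lemma graph_auts_conj F F' phi g :
  graph_iso F F' phi -> g \in graph_auts F' -> (g ^ phi)%g \in graph_auts F.
Proof.
move=> [adj [M injM phiM]] /graph_autsP[gF gv].
apply/graph_autsP; split=> p q; rewrite conjgE !permM.
  by rewrite adj gF -adj !permKV.
have -> : (phi^-1%g (p + vertical 6 q)) = phi^-1%g p + vertical 6 (invF injM q).
  by apply: (canLR (permK phi)); rewrite phiM permKV f_invF.
by rewrite gv phiM f_invF.
Qed.

Lemma graph_auts_conjE F F' phi :
  graph_iso F F' phi -> (graph_auts F' :^ phi)%g = graph_auts F.
Proof.
move=> iso; apply/setP=> g; apply/imsetP/idP => [[h Ah ->]|Ag].
  exact: graph_auts_conj iso Ah.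
exists (g ^ phi^-1)%g; last by rewrite conjgKV.
exact: graph_auts_conj (graph_iso_inv iso) Ag.
Qed.

Lemma pgroup_translations : 2.-group T.
Proof.
rewrite /pgroup card_translations !card_prod !card_mx !mul1n card_Fp //.
by rewrite !pnatM !pnatX !pnat_id // !orbT.
Qed.

Lemma translations_conj_rigid F (bentF : bent F) phi :
  (T :^ phi \subset graph_auts F -> T :^ phi \subset 'N(T) -> T \subset 'N(T :^ phi) ->
  T :^ phi = T)%g.
Proof.
move=> sA n1 n2; apply/eqP; rewrite eqEcard cardJg leqnn andbT.
apply: (rigid_subgroup (T1 := (T_group :^ phi)%G)) bentF sA _ _ _ n1 n2 => //.
- rewrite abelianJ; apply/centsP=> _ /imsetP[p _ ->] _ /imsetP[q _ ->].
  by apply/permP=> r; rewrite !permM !translE addrCA.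
- move=> _ /imsetP[_ /imsetP[p _ ->] ->]; rewrite -conjMg.
  suff -> : (transl p * transl p = 1)%g by rewrite conj1g.
  by apply/permP=> r; rewrite permM !translE addrA addW add0r perm1.
move=> p; pose t := transl (phi^-1%g p + phi^-1%g 0).
exists (t ^ phi)%g; first by rewrite memJ_conjg transl_in.
by rewrite conjgE !permM translE addWKK permKV.
Qed.

(** Both [T] and [T :^ phi] are weakly rigid in the group of [F], so fusion provides [a] such that
    [phi * a] normalises [T], hence is affine. *)
Lemma affine_graph_iso F F' phi : bent F -> bent F' -> graph_iso F F' phi ->
  exists2 psi : {perm W}, graph_iso F F' psi &
    forall p q, psi (p + q) = psi p + psi q + psi 0.
Proof.
move=> bentF bentF' iso.
have sT G : T \subset graph_auts G := translations_sub_graph_auts G.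
have rig G : bent G -> weakly_rigid (graph_auts G) T.
  move=> bentG a Aa; apply: (translations_conj_rigid bentG).
  exact: (@conj_subG _ (graph_auts_group G) _ _ Aa (sT G)).
have sTphi : (T :^ phi \subset graph_auts F)%g.
  by rewrite -(graph_auts_conjE iso) conjSg sT.
have rigphi : weakly_rigid (graph_auts F) (T :^ phi)%g.
  rewrite -(graph_auts_conjE iso).
  exact: (weakly_rigid_conj (A := graph_auts_group F') (T := T_group)) (rig F' bentF').
have [a Aa [n1 n2]] : exists2 a, a \in graph_auts F &
    ((T :^ phi) :^ a \subset 'N(T) /\ T \subset 'N((T :^ phi) :^ a))%g.
  have pT := pgroup_translations.
  apply: (@weakly_rigid_fusion _ 2 (graph_auts_group F) T_group (T_group :^ phi)%G) => //.
  - by rewrite pgroupJ.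
  - exact: sT.
  exact: rig.
move: n1 n2; rewrite -conjsgM => n1 n2.
have eT : (T :^ (phi * a) = T)%g.
  apply: (translations_conj_rigid bentF) n1 n2; rewrite conjsgM.
  exact: (@conj_subG _ (graph_auts_group F)).
exists (phi * a)%g; last first.
  have nT : (phi * a)%g \in 'N(T)%g by apply/normP.
  by move=> p q; rewrite norm_translations_affine // oppW.
have /graph_autsP[aF av] := Aa; case: iso => adj [M injM phiM].
split=> [p q|]; first by rewrite !permM aF adj.
by exists M => // p s; rewrite !permM phiM av.
Qed.

Lemma injective_unitmx n (f : vec n -> vec n) :
  (forall x y, f (x + y) = f x + f y) -> injective f -> mx_of f \in unitmx.
Proof.
move=> fD injf; rewrite -row_free_unit -kermx_eq0; apply/eqP/row_matrixP=> i.
by apply: injf; rewrite row0 additive0 // mx_ofE // -row_mul mulmx_ker row0.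
Qed.

(** The linear part [L] keeps vertical vectors vertical, so it is block triangular; its blocks [M],
    [lam], [alp] yield the equivalence. *)
Lemma EA_of_affine_graph_iso F F' psi : graph_iso F F' psi ->
  (forall p q, psi (p + q) = psi p + psi q + psi 0) -> EA_equiv F' F.
Proof.
move=> [adj [M injM psiM]] aff; pose L p := psi p + psi 0.
have LD p q : L (p + q) = L p + L q.
  by rewrite /L aff addWKK addrACA addW addr0.
have Lv s : L (vertical 6 s) = vertical 6 (M s).
  by rewrite /L -[vertical 6 s]add0r psiM addrAC addW add0r.
have injL : injective L by move=> p q /addIr/perm_inj.
have LF p : p \in lifted_graph F' -> L p \in lifted_graph F.
  by rewrite adj addr0.
pose h := @horizontal 6 m; pose b := base 6 m.
have h0 : h 0 = 0 by apply: ambient_ext.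
have L1 y : (L b).1.1 + (L (h y)).1.1 = 1.
  have : b + h y + vertical _ (F' y) \in lifted_graph F' by apply/lifted_graphP; exists y.
  move/LF; rewrite !LD Lv inE => /andP[/eqP e _].
  by rewrite -[RHS]e /= addr0.
have L0 : L 0 = 0 by rewrite /L addW.
have Lb : (L b).1.1 = 1 by rewrite -(L1 0) h0 L0 addr0.
have Lh y : (L (h y)).1.1 = 0.
  by apply: (@addrI 'F_2 1); rewrite -{1}Lb L1 addr0.
pose lam y := (L (h y)).1.2; pose alp y := (L (h y)).2.
have hD x y : h (x + y) = h x + h y by apply: horizontalD.
have lamD x y : lam (x + y) = lam x + lam y by rewrite /lam hD LD.
have alpD x y : alp (x + y) = alp x + alp y by rewrite /alp hD LD.
have MD s t : M (s + t) = M s + M t.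
  have : vertical 6 (M (s + t)) = vertical 6 (M s) + vertical 6 (M t).
    by rewrite -!Lv verticalD LD.
  by case.
have M0 : M 0 = 0 by apply: additive0.
have Minv : exists2 M' : 'M['F_2]_m, M' \in unitmx & forall s, M s *m M' = s.
  exists (invmx (mx_of M)); first by rewrite unitmx_inv injective_unitmx.
  by move=> s; rewrite mx_ofE // mulmxK // injective_unitmx.
(* If [lam x = lam y], then [L (h x + h y)] is vertical, hence the image of a vertical vector. *)
have injlam : injective lam.
  move=> x y exy; have : L (h x + h y) = L (vertical 6 (invF injM (alp x + alp y))).
    rewrite Lv f_invF LD; apply: ambient_ext.
    - exact: etrans (congr2 +%R (Lh x) (Lh y)) (addr0 _).
    - by have := addrv (lam x); rewrite {2}exy.
    - by [].
  move/injL; rewrite -hD; case=> /addr0_eq; rewrite oppv => -> //.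
have key y : F (lam y + (L b).1.2) = M (F' y) + (alp y + (L b).2).
  have : b + h y + vertical _ (F' y) \in lifted_graph F' by apply/lifted_graphP; exists y.
  move/LF; rewrite !LD Lv inE => /andP[_ /eqP e].
  have {}e : (L b).2 + alp y + M (F' y) = F ((L b).1.2 + lam y + 0) := e.
  by rewrite addrC -[_ + lam y]addr0 -e addrC (addrC _ (alp y)).
have [M' uM' MK] := Minv.
exists M', (mx_of lam), (L b).1.2, (mx_of alp *m M'), ((L b).2 *m M').
split=> //; split; first exact: injective_unitmx.
move=> y; rewrite -mx_ofE // key mulmxDl MK mulmxA -mx_ofE // -mulmxDl.
by rewrite addvKK.
Qed.

End Frames.

(** * From developments to lifted graphs *)

Section Development.
Variables (n m : nat).
Hypotheses (n_gt0 : (0 < n)%N) (m_gt0 : (0 < m)%N).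
Notation W := ('F_2 * vec n * vec m)%type.
Notation pt := (point n m).
Implicit Types (F : vec n -> vec m) (g x : pt).

Definition block F g : {set pt} := translate (graphF F) g.

Lemma mem_block F g x : (x \in block F g) = (x.2 + g.2 == F (x.1 + g.1)).
Proof.
apply/imsetP/eqP => [[_ /imsetP[y _ ->] ->]|e]; first by rewrite /= !addvKK.
exists (x.1 + g.1, F (x.1 + g.1)); first exact: imset_f.
by rewrite -e; case: x g {e} => [x t] [u v]; rewrite /padd /= !addvKK.
Qed.

Lemma exists_nonzero k : (0 < k)%N -> exists v : vec k, v != 0.
Proof.
move=> k_gt0; exists (const_mx 1); apply/eqP=> /rowP/(_ (Ordinal k_gt0)).
by rewrite !mxE.
Qed.

(** Equal blocks with distinct horizontal shifts would give a constant derivative. *)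
Lemma block_inj F : bent F -> injective (block F).
Proof.
move=> bentF [u v] [u' v'] /setP e.
have eF y : F (y + (u + u')) + F y = v + v'.
  have := e (y + u, F y + v); rewrite !mem_block /= !addvKK eqxx.
  move/esym/eqP; rewrite -!addrA => <-.
  by rewrite addrAC addrv add0r.
have [eu|nu] := eqVneq (u + u') 0.
  have eu' : u = u' by rewrite -[u]oppv (addr0_eq eu).
  congr (_, _) => //; have := eF 0; rewrite eu addr0 addrv => /esym/addr0_eq.
  by rewrite oppv.
have [w w0] := exists_nonzero m_gt0.
have [y] := bent_derivative_onto bentF (v + v' + w) nu.
by rewrite eF -[LHS]addr0 => /addrI e0; rewrite -e0 eqxx in w0.
Qed.

(** In layer 0, [phi] acts on points; in layer 1, [tau] acts on blocks, labelled by their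
    translation vectors. *)
Definition incidence_perm_fun (phi tau : pt -> pt) (p : W) : W :=
  let x := (if p.1.1 == 0 then phi else tau) (p.1.2, p.2) in (p.1.1, x.1, x.2).

Lemma incidence_perm_inj phi tau : injective phi -> injective tau ->
  injective (incidence_perm_fun phi tau).
Proof.
move=> ip it [[e y] t] [[e' y'] t']; rewrite /incidence_perm_fun /=.
case: ifP => e0 [<-]; rewrite e0 => e1 e2.
  have /ip[-> ->] // : phi (y, t) = phi (y', t').
  by case: (phi _) (phi _) e1 e2 => [? ?] [? ?] /= -> ->.
have /it[-> ->] // : tau (y, t) = tau (y', t').
by case: (tau _) (tau _) e1 e2 => [? ?] [? ?] /= -> ->.
Qed.

Lemma lifted_perm_of_dev_iso F F' : bent F' -> dev_iso F F' ->
  exists2 psi : {perm W}, (forall p, (psi p).1.1 = p.1.1) &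
    forall p q, (psi p + psi q \in lifted_graph F) = (p + q \in lifted_graph F').
Proof.
move=> bentF' [phi ephi].
have tau_ex g : exists h, phi @: block F' g = block F h.
  have : phi @: block F' g \in dev_blocks F.
    rewrite -ephi; apply: imset_f; exact: imset_f.
  by case/imsetP=> h _ ->; exists h.
have [tau tauE] := fin_all_exists tau_ex.
have tau_inj : injective tau.
  move=> g h e; apply: (block_inj bentF').
  by apply: (imset_inj (@perm_inj _ phi)); rewrite !tauE e.
have inc x g : (phi x \in block F (tau g)) = (x \in block F' g).
  by rewrite -tauE mem_imset //; exact: perm_inj.
have inc' x g : ((phi x).2 + (tau g).2 == F ((phi x).1 + (tau g).1)) =
    (x.2 + g.2 == F' (x.1 + g.1)) by rewrite -!mem_block inc.
have incC x g : ((tau g).2 + (phi x).2 == F ((tau g).1 + (phi x).1)) =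
    (g.2 + x.2 == F' (g.1 + x.1)).
  by rewrite addrC [(tau g).1 + _]addrC inc' addrC [x.1 + _]addrC.
exists (perm (incidence_perm_inj (@perm_inj _ phi) tau_inj)) => [p|p q].
  by rewrite permE.
rewrite !inE !permE /incidence_perm_fun /=.
case: p q => [[e y] t] [[e' y'] t'] /=.
by case: (F2P e) => ->; case: (F2P e') => ->; rewrite /= ?inc' ?incC.
Qed.

Lemma common_neighbour F (p q : W) : bent F -> p.1.1 = q.1.1 -> p.1.2 != q.1.2 ->
  exists2 r, p + r \in lifted_graph F & q + r \in lifted_graph F.
Proof.
case: p q => [[e x] t] [[_ x'] t'] bentF /= <- nx.
have w0 : x + x' != 0 by rewrite -[x']oppv subr_eq0.
have [z ez] := bent_derivative_onto bentF (t + t') w0.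
exists (e + 1, x + z, t + F z); rewrite inE /=; apply/andP; split; apply/eqP.
- by rewrite addrA addF2K add0r.
- by rewrite !addrA !addrv !add0r.
- by rewrite addrA addF2K add0r.
have -> : x' + (x + z) = z + (x + x') by rewrite addrCA addrA addrC.
by rewrite -[RHS](addvKK _ (F z)) ez addrA [t' + t]addrC.
Qed.

(** Fibres are visible in the graph: two vertices of one layer in different fibres have a common
    neighbour, while distinct vertices of one fibre have none. *)
Lemma fibre_shift F F' (psi : {perm W}) : bent F -> bent F' ->
  (forall p, (psi p).1.1 = p.1.1) ->
  (forall p q, (psi p + psi q \in lifted_graph F) = (p + q \in lifted_graph F')) ->
  exists2 M : vec m -> vec m, injective M &
    forall p s, psi (p + vertical n s) = psi p + vertical n (M s).
Proof.
move=> bentF bentF' psi1 adj.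
have fib p s : (psi (p + vertical n s)).1.2 = (psi p).1.2.
  apply/eqP/contraT=> nfib.
  have e1 : (psi (p + vertical n s)).1.1 = (psi p).1.1 by rewrite !psi1 /= addr0.
  have [R] := common_neighbour bentF e1 nfib; rewrite -[R](permKV psi) !adj.
  rewrite !inE => /andP[_ /eqP /= es] /andP[_ /eqP].
  rewrite /= -(addr0 p.1.2) -es [p.2 + s]addrC -addrA -[LHS]add0r => /addIr s0.
  by case/eqP: nfib; rewrite -s0 addr0.
pose dl t p := (psi (p + vertical n t)).2 + (psi p).2.
(* Shifting both ends of an edge by the same vertical vector gives an edge, so the displacement
   [dl t] agrees at its ends. *)
have edge t p r : p + r \in lifted_graph F' -> dl t p = dl t r.
  move=> pr; have := pr; rewrite -adj inE => /andP[_ /eqP /= e1].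
  have : (p + vertical n t) + (r + vertical n t) \in lifted_graph F'.
    by rewrite addrACA addW addr0.
  rewrite -adj inE => /andP[_ /eqP /=]; rewrite !fib -e1 => e2.
  by rewrite /dl; apply/eqP; rewrite -subr_eq0 oppv addrACA e2 addrv.
have far t p q : p.1.1 = q.1.1 -> p.1.2 != q.1.2 -> dl t p = dl t q.
  by move=> e1 e2; have [r /edge-> /edge->] := common_neighbour bentF' e1 e2.
have [w w0] := exists_nonzero n_gt0.
(* Within a fibre, the comparison passes through a vertex of another fibre. *)
have same t p q : p.1.1 = q.1.1 -> dl t p = dl t q.
  move=> e1; have [e2|] := eqVneq p.1.2 q.1.2; last exact: far.
  have nw : p.1.2 != (p + horizontal m w).1.2.
    by rewrite /= -{1}[p.1.2]addr0 (inj_eq (addrI _)) eq_sym.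
  rewrite (far t p (p + horizontal m w)) //; last by rewrite /= addr0.
  by symmetry; apply: far; rewrite /= ?addr0 -?e2.
have const t p q : dl t p = dl t q.
  have [|ne] := eqVneq p.1.1 q.1.1; first exact: same.
  pose r : W := (p.1.1 + 1, p.1.2, p.2 + F' 0).
  have -> : dl t p = dl t r.
    apply: edge; rewrite inE /= addrA addF2K add0r eqxx /=.
    by rewrite addrA !addrv add0r.
  apply: same; rewrite /r /=.
  move: ne; case: (F2P p.1.1) => ->; case: (F2P q.1.1) => ->;
  by rewrite ?eqxx ?addF2K ?add0r.
have shift p s : psi (p + vertical n s) = psi p + vertical n (dl s 0).
  rewrite -(const s p); apply: ambient_ext; rewrite /= ?fib ?psi1 /= ?addr0 //.
  by rewrite /dl addrCA addrv addr0.
exists (fun s => dl s 0) => // s t e.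
by have := shift 0 s; rewrite e -shift => /perm_inj; rewrite !add0r; case.
Qed.

End Development.

Lemma graph_iso_of_dev_iso m (F F' : vec 6 -> vec m) : (0 < m)%N ->
  bent F -> bent F' -> dev_iso F F' -> exists phi, graph_iso F F' phi.
Proof.
move=> m0 bentF bentF' /(lifted_perm_of_dev_iso m0 bentF')[phi phi1 adj].
by exists phi; split=> //; apply: fibre_shift bentF bentF' phi1 adj.
Qed.

(** * EA-equivalence gives isomorphism, and the conclusion *)

Lemma dev_iso_of_EA n m (F F' : vec n -> vec m) : EA_equiv F F' -> dev_iso F F'.
Proof.
case=> M1 [L2 [c2 [N3 [d3 [uM [uL eF]]]]]].
pose back (x : vec n) := (x + c2) *m invmx L2.
have backK x : back x *m L2 + c2 = x by rewrite /back mulmxKV // addvKK.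
(* This carries the graph of [F'] to that of [F] up to the constant [d3], which the block map [tau]
   absorbs. *)
pose phi (p : point n m) : point n m := (back p.1, p.2 *m M1 + back p.1 *m N3).
have phi_inj : injective phi.
  move=> [x t] [x' t'] [] ex; have exx : x = x' by rewrite -[x]backK ex backK.
  by rewrite exx => /addIr e; rewrite -[t](mulmxK uM) e mulmxK.
pose tau (g : point n m) : point n m :=
  (g.1 *m invmx L2, g.2 *m M1 + g.1 *m invmx L2 *m N3 + d3).
pose tau' (h : point n m) : point n m :=
  (h.1 *m L2, (h.2 + h.1 *m N3 + d3) *m invmx M1).
have tau'K h : tau (tau' h) = h.
  by case: h => u v; rewrite /tau /tau' /= mulmxK // mulmxKV // addrAC !addvKK.
have imE g : [set phi p | p in translate (graphF F') g] = translate (graphF F) (tau g).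
  apply/setP=> q; rewrite [RHS]mem_block.
  have [p ->] : exists p, q = phi p.
    by exists (invF phi_inj q); rewrite f_invF.
  rewrite mem_imset // [LHS]mem_block /= eF mulmxDl.
  have -> : g.1 *m invmx L2 *m L2 = g.1 by rewrite mulmxKV.
  rewrite [_ + g.1 + c2]addrAC backK [(back p.1 + _) *m N3]mulmxDl.
  have -> : p.2 *m M1 + back p.1 *m N3 + (g.2 *m M1 + g.1 *m invmx L2 *m N3 + d3) =
      (p.2 + g.2) *m M1 + (back p.1 *m N3 + g.1 *m invmx L2 *m N3 + d3).
    by rewrite mulmxDl -(addrA (g.2 *m M1)) addrACA -(addrA (back p.1 *m N3)).
  by rewrite (inj_eq (addIr _)) (inj_eq (can_inj (mulmxK uM))).
exists (perm phi_inj); apply/setP=> B.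
apply/imsetP/imsetP => [[C /imsetP[g _ ->] ->]|[h _ ->]].
  exists (tau g) => //; rewrite -imE; apply: eq_imset => p; exact: permE.
exists (translate (graphF F') (tau' h)); first exact: imset_f.
rewrite -{1}[h]tau'K -imE; apply: eq_imset => p; exact/esym/permE.
Qed.

Local Close Scope ring_scope.

Theorem theorem4 (m : nat) (Hm : (m == 2) || (m == 3))
  (F F' : vec 6 -> vec m) (HF : bent F) (HF' : bent F') :
  EA_equiv F F' <-> dev_iso F F'.
Proof.
split=> [|iso]; first exact: dev_iso_of_EA.
have m0 : (0 < m)%N by case/orP: Hm => /eqP->.
(* The inverse carries the lifted graph of [F] to that of [F'], the direction that expresses [F]
   through [F']. *)
have [phi /graph_iso_inv iso'] := graph_iso_of_dev_iso m0 HF HF' iso.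
have [psi psi_iso aff] := affine_graph_iso Hm HF' HF iso'.
exact: EA_of_affine_graph_iso psi_iso aff.
Qed.
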